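(* Let $B$ and $C$ be finite Blaschke products with $\deg B = \deg C$. If there is some $r \in (0,1)$ with $\Omega_r^B \subseteq \Omega_r^C$, then there exists $\lambda \in \mathbb{T}$ such that $B = \lambda C$.
   Context: $\mathbb{D}$ is the open unit disk and $\mathbb{T}$ the unit circle in $\mathbb{C}$. A finite Blaschke product of degree $n$ is a rational function $B(z) = \lambda \prod_{j=1}^n \frac{z-a_j}{1-\bar{a}_j z}$ with $a_1,\dots,a_n \in \mathbb{D}$ (not necessarily distinct) and $\lambda\in\mathbb{T}$. For a finite Blaschke product $B$ and $r\in(0,1)$, the open level set is $\Omega_r^B = \{z\in\mathbb{C} : |B(z)|<r\}$ (poles of $B$ do not belong to it). *)

(* Defs.v *)
From mathcomp Require Import all_boot all_order all_algebra.
From mathcomp Require Import complex.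
From mathcomp Require Import classical_sets reals.

Set Implicit Arguments.
Unset Strict Implicit.
Unset Printing Implicit Defensive.

Import Order.TTheory GRing.Theory Num.Theory.
Local Open Scope classical_set_scope.
Local Open Scope complex_scope.
Local Open Scope ring_scope.

Local Notation "x %:F" := (FracField.tofrac x).

Notation ratfun R := {fraction {poly R[i]}}.

Definition ratfun_const (R : realType) (c : R[i]) : ratfun R := c%:P%:F.

(* The existential makes a removable singularity of a particular writing p / q
   harmless: [f] has a value at [z] if and only if [z] is not a pole of [f],
   and that value does not depend on the chosen p and q. *)
Definition ratfun_value (R : realType) (f : ratfun R) (z w : R[i]) : Prop :=
  exists p q : {poly R[i]},
    [/\ f = p%:F / q%:F, q.[z] != 0 & w = p.[z] / q.[z]].

Definition blaschke (R : realType) (n : nat) (lambda : R[i])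
    (a : 'I_n -> R[i]) : ratfun R :=
  ratfun_const lambda *
  \prod_(j < n) (('X - (a j)%:P)%:F / (1 - ((a j)^*)%:P * 'X)%:F).

Definition finite_blaschke (R : realType) (n : nat) (B : ratfun R) : Prop :=
  exists (lambda : R[i]) (a : 'I_n -> R[i]),
    [/\ `|lambda| = 1, (forall j, `|a j| < 1) & B = blaschke lambda a].

Definition level_set (R : realType) (r : R) (B : ratfun R) : set R[i] :=
  [set z | exists2 w, ratfun_value B z w & `|w| < r%:C].

(* Main.v *)
(** Write B = P/Q and C = S/T with Q, T products of factors 1 - conj(a) z.  On
    the part of the closed disc where |C| >= r one has |B| >= r, so C/B has
    modulus at most 1 on the boundary of that region; by the maximum principle
    |C| <= |B| there, in particular near the unit circle.  Comparing first-order
    terms at the circle, where |B| = |C| = 1, bounds the sum of the Poisson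
    kernels of the zeros of B by that of C.  As both sums have n terms, their
    difference is the boundary value of the real part of 2z(Q'/Q - T'/T), which
    has no pole in the closed disc and vanishes at 0, so by the minimum principle
    it vanishes identically.  Hence Q = T, and P and S agree up to a constant by
    reflection in the circle. *)
Require Import Defs.
From mathcomp Require Import all_boot all_order all_algebra.
From mathcomp Require Import complex.
From mathcomp Require Import classical_sets reals.
From mathcomp Require Import boolp topology normedtype derive ring lra.

Set Implicit Arguments.
Unset Strict Implicit.
Unset Printing Implicit Defensive.

Import Order.TTheory GRing.Theory Num.Theory.
Import numFieldNormedType.Exports.
Local Open Scope classical_set_scope.
Local Open Scope complex_scope.
Local Open Scope ring_scope.

Local Notation Re := complex.Re.
Local Notation Im := complex.Im.
Local Notation "x %:F" := (FracField.tofrac x).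

(** * Real-valued squared modulus, and continuity of polynomial expressions on the plane *)

Definition nsq (R : realType) (z : R[i]) : R := Re z ^+ 2 + Im z ^+ 2.

(* The plane is modelled by R * R, whose topology provides compactness. *)
Definition cpx (R : realType) (z : R * R) : R[i] := z.1 +i* z.2.

Lemma Re_mulc (R : realType) (z w : R[i]) :
  Re (z * w) = Re z * Re w - Im z * Im w.
Proof. by case: z w => [a b] [c d]. Qed.

Lemma Im_mulc (R : realType) (z w : R[i]) :
  Im (z * w) = Re z * Im w + Im z * Re w.
Proof. by case: z w => [a b] [c d]. Qed.

Lemma continuous_Re_Im_horner (R : realType) (p : {poly R[i]}) :
  continuous (fun z : R * R => Re p.[cpx z]) /\
  continuous (fun z : R * R => Im p.[cpx z]).
Proof.
elim/poly_ind: p => [|p c [cRe cIm]].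
  by split=> z; under eq_fun do rewrite horner0; exact: cvg_cst.
have cx : continuous (fun z : R * R => z.1) by move=> z; exact: cvg_fst.
have cy : continuous (fun z : R * R => z.2) by move=> z; exact: cvg_snd.
split.
  have -> : (fun z : R * R => Re (p * 'X + c%:P).[cpx z]) =
      (fun z => Re p.[cpx z] * z.1 - Im p.[cpx z] * z.2 + Re c).
    by apply: funext => z; rewrite hornerMXaddC raddfD /= Re_mulc.
  move=> z; apply: cvgD; last exact: cvg_cst.
  by apply: cvgB; apply: cvgM; [exact: cRe|exact: cx|exact: cIm|exact: cy].
have -> : (fun z : R * R => Im (p * 'X + c%:P).[cpx z]) =
    (fun z => Re p.[cpx z] * z.2 + Im p.[cpx z] * z.1 + Im c).
  by apply: funext => z; rewrite hornerMXaddC raddfD /= Im_mulc.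
move=> z; apply: cvgD; last exact: cvg_cst.
by apply: cvgD; apply: cvgM; [exact: cRe|exact: cy|exact: cIm|exact: cx].
Qed.

Lemma nsqM (R : realType) (z w : R[i]) : nsq (z * w) = nsq z * nsq w.
Proof. by rewrite /nsq Re_mulc Im_mulc; ring. Qed.

Lemma nsq_eq0 (R : realType) (z : R[i]) : (nsq z == 0) = (z == 0).
Proof.
by case: z => a b; rewrite /nsq eq_complex /= paddr_eq0 ?sqr_ge0// !sqrf_eq0.
Qed.

Lemma nsqV (R : realType) (z : R[i]) : nsq z^-1 = (nsq z)^-1.
Proof.
have [->|z0] := eqVneq z 0; first by rewrite invr0 /nsq /= !expr0n addr0 invr0.
apply: (mulfI (x := nsq z)); rewrite ?nsq_eq0//.
by rewrite -nsqM !divff ?nsq_eq0// /nsq /=; ring.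
Qed.

Lemma nsq_ge0 (R : realType) (z : R[i]) : 0 <= nsq z.
Proof. by rewrite addr_ge0 ?sqr_ge0. Qed.

Lemma continuous_nsq_horner (R : realType) (p : {poly R[i]}) :
  continuous (fun z : R * R => nsq p.[cpx z]).
Proof.
have [cRe cIm] := continuous_Re_Im_horner p.
move=> z; rewrite /nsq; apply: cvgD; apply: cvgM;
  by [exact: cRe|exact: cIm].
Qed.

Lemma continuous_cpx_nsq (R : realType) :
  continuous (fun z : R * R => nsq (cpx z)).
Proof.
have -> : (fun z : R * R => nsq (cpx z)) = (fun z => nsq 'X.[cpx z]).
  by apply: funext => z; rewrite hornerX.
exact: continuous_nsq_horner.
Qed.

Lemma closed_le_fun (T : topologicalType) (R : realType) (f g : T -> R) :
  continuous f -> continuous g -> closed [set z | f z <= g z].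
Proof.
move=> cf cg.
have -> : [set z | f z <= g z] = (fun z => g z - f z) @^-1` [set x | 0 <= x].
  by apply/seteqP; split=> z /=; rewrite subr_ge0.
apply: preimage_closed; last exact: closed_ge.
by move=> z _; apply: cvgB; [exact: cg|exact: cf].
Qed.

Lemma compact_disc (R : realType) : compact [set z : R * R | nsq (cpx z) <= 1].
Proof.
have cI := @segment_compact R (-1) 1.
apply: (subclosed_compact _ (compact_setX cI cI)).
  by apply: closed_le_fun; [exact: continuous_cpx_nsq|move=> z; exact: cvg_cst].
move=> [x y]; rewrite /nsq /= !in_itv /= => h.
by split; apply/andP; split; nra.
Qed.

Lemma Re_divc (R : realType) (a b : R[i]) :
  Re (a / b) = (Re a * Re b + Im a * Im b) / nsq b.
Proof. by case: a b => [a1 a2] [b1 b2]; rewrite /nsq /=; ring. Qed.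

Lemma continuous_Re_div (R : realType) (N D : {poly R[i]}) (z : R * R) :
  D.[cpx z] != 0 ->
  {for z, continuous (fun z : R * R => Re (N.[cpx z] / D.[cpx z]))}.
Proof.
move=> D0.
have -> : (fun z : R * R => Re (N.[cpx z] / D.[cpx z])) = (fun z =>
    (Re N.[cpx z] * Re D.[cpx z] + Im N.[cpx z] * Im D.[cpx z]) / nsq D.[cpx z]).
  by apply: funext => w; rewrite Re_divc.
have [cNr cNi] := continuous_Re_Im_horner N.
have [cDr cDi] := continuous_Re_Im_horner D.
apply: cvgM; last by apply: cvgV; [rewrite nsq_eq0|exact: continuous_nsq_horner].
by apply: cvgD; apply: cvgM; [exact: cNr|exact: cDr|exact: cNi|exact: cDi].
Qed.

Lemma near_horner_neq0 (R : realType) (D : {poly R[i]}) (z0 : R * R) :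
  D.[cpx z0] != 0 -> \forall z \near z0, D.[cpx z] != 0.
Proof.
move=> D0; have : 0 < nsq D.[cpx z0] by rewrite lt_def nsq_eq0 D0 nsq_ge0.
move=> /(cvgr_gt _ (@continuous_nsq_horner R D z0)); apply: filterS => z.
by rewrite lt_def nsq_eq0 => /andP[].
Qed.

(** * Maximum and minimum principles for quotients of polynomials *)

Lemma cpx_line (R : realType) (z : R * R) (s : R) (v : R[i]) :
  cpx (z.1 + s * Re v, z.2 + s * Im v) = cpx z + s%:C * v.
Proof.
by case: z v => [x y] [a b]; apply/eqP; rewrite eq_complex /=; apply/andP;
  split; apply/eqP; ring.
Qed.

Lemma cvg_line (R : realType) (z v : R * R) :
  (z.1 + s * v.1, z.2 + s * v.2) @[s --> (0 : R)^'+] --> z.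
Proof.
rewrite [z in X in _ --> X]surjective_pairing.
have h (a b : R) : a + s * b @[s --> (0 : R)^'+] --> a.
  rewrite -[X in _ --> X]addr0 -[X in _ --> _ + X](mul0r b).
  apply: cvgD; first exact: cvg_cst.
  apply: cvgM; last exact: cvg_cst.
  by apply: cvg_at_right_filter; exact: cvg_id.
exact: (cvg_pair (h _ _) (h _ _)).
Qed.

(* Open mapping: if N - f0 D vanishes to order k at z0, then N / D - f0 behaves
   like a constant times (z - z0)^k, so z - z0 is taken along a suitable k-th
   root. *)
Lemma quotient_increases (R : realType) (N D : {poly R[i]}) (z0 : R * R)
    (u : R[i]) (U : set (R * R)) :
  let f0 := N.[cpx z0] / D.[cpx z0] in
  D.[cpx z0] != 0 -> u != 0 -> N != f0 *: D -> nbhs z0 U ->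
  exists2 z, U z & D.[cpx z] != 0 /\ 0 < Re ((N.[cpx z] / D.[cpx z] - f0) / u).
Proof.
move=> f0 D0 u0 NfD Uz0; set c := cpx z0.
have E0 : N - f0 *: D != 0 by rewrite subr_eq0.
have [[|k] [G + defE]] := multiplicity_XsubC (N - f0 *: D) c; rewrite E0 /= => Gc.
  (* Multiplicity zero is impossible: [N - f0 *: D] vanishes at [c] by the choice of [f0]. *)
  move: Gc; rewrite expr0 mulr1 in defE.
  by rewrite /root -defE hornerD hornerN hornerZ /f0 divfK // subrr eqxx.
have Gc0 : G.[c] != 0 by [].
(* With this root, the leading term of [(N / D - f0) / u] at [c + s * eta] is exactly
   [s ^+ k.+1]. *)
have [eta etaE] : exists eta, eta ^+ k.+1 = D.[c] * u / G.[c].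
  by exists (k.+1.-root (D.[c] * u / G.[c])); rewrite rootCK.
pose path (s : R) : R * R := (z0.1 + s * Re eta, z0.2 + s * Im eta).
have pathE s : cpx (path s) = c + s%:C * eta.
  exact: cpx_line.
have cpath : path s @[s --> (0 : R)^'+] --> z0.
  exact: (@cvg_line R z0 (Re eta, Im eta)).
(* This is the cofactor of [s ^+ k.+1] in [(N / D - f0) / u]; it equals 1 at [z0], so its real part
   stays positive nearby. *)
have HW : \forall z \near z0, 0 < Re (((D.[c] / G.[c]) *: G).[cpx z] / D.[cpx z]).
  apply: (cvgr_gt _ (@continuous_Re_div R _ D z0 D0)).
  by rewrite hornerZ divfK // divff.
have [s [s0 [Us [Ds Ws]]]] : exists s : R,
    0 < s /\ U (path s) /\ D.[cpx (path s)] != 0 /\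
    0 < Re (((D.[c] / G.[c]) *: G).[cpx (path s)] / D.[cpx (path s)]).
  apply: (@filter_ex _ (0 : R)^'+).
  near=> s; split; first by near: s; exact: nbhs_right_gt.
  split; first by near: s; exact: cpath Uz0.
  split; first by near: s; exact: cpath (near_horner_neq0 D0).
  by near: s; exact: cpath HW.
exists (path s) => //; split=> //.
have -> : (N.[cpx (path s)] / D.[cpx (path s)] - f0) / u =
    (s ^+ k.+1)%:C * (((D.[c] / G.[c]) *: G).[cpx (path s)] / D.[cpx (path s)]).
  have : (N - f0 *: D).[cpx (path s)] = G.[cpx (path s)] * (s%:C * eta) ^+ k.+1.
    by rewrite defE hornerM horner_exp hornerXsubC pathE [c + _]addrC addrK.
  rewrite exprMn etaE hornerD hornerN !hornerZ rmorphXn => /(canRL (subrK _)) ->.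
  by field; rewrite Ds u0 Gc0.
by rewrite Re_mulc /= mul0r subr0 mulr_gt0 ?exprn_gt0.
Unshelve. all: by end_near.
Qed.

(** Maximum principle for [N / D]. The modulus attains its maximum on [K]; at an interior point with
    nonzero value, a nonconstant quotient takes a larger modulus nearby, so the maximum sits where
    the bound is assumed or where [N] vanishes. *)
Lemma nsq_quotient_le (R : realType) (N D : {poly R[i]}) (K : set (R * R)) :
  compact K -> (forall z, K z -> D.[cpx z] != 0) ->
  (forall z, K z -> nsq N.[cpx z] <= nsq D.[cpx z] \/ nbhs z K) ->
  (forall f0, N != f0 *: D) ->
  forall z, K z -> nsq N.[cpx z] <= nsq D.[cpx z].
Proof.
move=> cK D0 bK nconst z Kz.
pose g (w : R * R) := nsq N.[cpx w] / nsq D.[cpx w].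
have D0' w : K w -> 0 < nsq D.[cpx w].
  by move=> /D0 h; rewrite lt_def nsq_eq0 h nsq_ge0.
have cg : {within K, continuous g}.
  apply: continuous_in_subspaceT => w /set_mem Kw.
  apply: cvgM; first exact: continuous_nsq_horner.
  by apply: cvgV; [rewrite gt_eqF ?D0'|exact: continuous_nsq_horner].
have [z0 /set_mem Kz0 gmax] := compact_EVT_max (ex_intro _ z Kz) cK cg.
suff g1 : g z0 <= 1.
  have := le_trans (gmax z (mem_set Kz)) g1.
  by rewrite /g ler_pdivrMr ?mul1r ?D0'.
have [Nz0|nK] := bK z0 Kz0; first by rewrite /g ler_pdivrMr ?mul1r ?D0'.
have [N0|N0] := eqVneq N.[cpx z0] 0.
  by rewrite /g N0 /nsq /= !expr0n /= addr0 mul0r ler01.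
have f00 : N.[cpx z0] / D.[cpx z0] != 0 by rewrite mulf_neq0 ?invr_eq0 ?D0.
(* The direction [u] is the value at [z0] itself, so the ratio of the value at [w] to that at [z0]
   has real part above 1, hence modulus above 1. *)
have [w Kw [Dw Hw]] := quotient_increases (D0 _ Kz0) f00 (nconst _) nK.
move: Hw; rewrite mulrBl divff// raddfB /= subr_gt0 => Hw.
have nsq_gt1 (v : R[i]) : 1 < Re v -> 1 < nsq v.
  by move=> v1; rewrite /nsq; have := sqr_ge0 (Im v); nra.
move: Hw => /nsq_gt1.
rewrite !(nsqM, nsqV) -/(g w) -/(g z0) ltr_pdivlMr ?mul1r; last first.
  by rewrite divr_gt0 ?D0'// lt_def nsq_eq0 N0 nsq_ge0.
by move=> /(le_lt_trans (gmax w (mem_set Kw))); rewrite ltxx.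
Qed.

Lemma nbhs_open_disc (R : realType) (z : R * R) (U : set (R * R)) :
  nsq (cpx z) < 1 -> (forall w, nsq (cpx w) < 1 -> U w) -> nbhs z U.
Proof.
move=> z1 HU.
by apply: filterS (cvgr_lt _ (@continuous_cpx_nsq R z) _ z1) => w; exact: HU.
Qed.

(** Minimum principle: if [N] were nonzero, [N / D] would be nonconstant, because it vanishes at 0,
    and its real part could not attain its minimum over the closed disc at an interior point. *)
Lemma Re_quotient_eq0 (R : realType) (N D : {poly R[i]}) :
  (forall z, nsq z <= 1 -> D.[z] != 0) -> N.[0] = 0 ->
  (forall z, nsq z = 1 -> 0 <= Re (N.[z] / D.[z])) -> N = 0.
Proof.
move=> D0 N0 bd; apply/eqP; apply: contraT => Nneq0.
have nconst f0 : N != f0 *: D.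
  apply: contra Nneq0 => /eqP defN; move: N0; rewrite defN hornerZ.
  move/eqP; rewrite mulf_eq0 (negbTE (D0 0 _)) ?orbF; last first.
    by rewrite /nsq /= !expr0n addr0 ler01.
  by move=> /eqP->; rewrite scale0r.
pose K := [set z : R * R | nsq (cpx z) <= 1].
have cg : {within K, continuous (fun z : R * R => Re (N.[cpx z] / D.[cpx z]))}.
  apply: continuous_in_subspaceT => w /set_mem Kw.
  by apply: continuous_Re_div; exact: D0.
have K0 : K (0, 0) by rewrite /K /nsq /= !expr0n addr0 ler01.
have [z0 /set_mem Kz0 gmin] :=
  compact_EVT_min (ex_intro _ _ K0) (@compact_disc R) cg.
(* Increasing in the direction -1 means decreasing the real part. *)
have N1 : (-1 : R[i]) != 0 by rewrite oppr_eq0 oner_eq0.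
have noint z : nsq (cpx z) < 1 ->
    Re (N.[cpx z] / D.[cpx z]) <= Re (N.[cpx z0] / D.[cpx z0]) -> False.
  move=> z1 zmin.
  have nK : nbhs z K by apply: nbhs_open_disc => // w /ltW.
  have [w Kw [Dw Hw]] := quotient_increases (D0 _ (ltW z1)) N1 (nconst _) nK.
  move: Hw; rewrite invrN1 mulrN1 opprB raddfB /= subr_gt0.
  move=> /lt_le_trans /(_ zmin) /lt_le_trans /(_ (gmin w (mem_set Kw))).
  by rewrite ltxx.
have [z1|z1] := ltP (nsq (cpx z0)) 1; first by case: (noint z0 z1).
(* The minimum is on the circle, hence nonnegative; the value 0 at the origin is then also minimal,
   at an interior point. *)
have c00 : cpx (0, 0) = 0 :> R[i] by [].
case: (noint (0, 0)); rewrite c00.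
  by rewrite /nsq /= !expr0n addr0 ltr01.
rewrite N0 mul0r /=; apply: bd.
by apply/eqP; rewrite eq_le z1 Kz0.
Qed.

Lemma exists_in_open_disc (R : realType) (z : R * R) (U : set (R * R)) :
  nsq (cpx z) = 1 -> nbhs z U -> exists2 w, U w & nsq (cpx w) < 1.
Proof.
move=> z1 Uz.
(* Radial motion inwards: the path is [(1 - s) * z]. *)
pose path (s : R) : R * R := (z.1 + s * Re (- cpx z), z.2 + s * Im (- cpx z)).
have [s [Us s0 s1]] : exists s, [/\ U (path s), 0 < s & s < 1].
  apply: (@filter_ex _ (0 : R)^'+).
  near=> s; split.
  - by near: s; exact: (@cvg_line R z (Re (- cpx z), Im (- cpx z))) Uz.
  - by near: s; exact: nbhs_right_gt.
  - by near: s; exact: nbhs_right_lt.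
exists (path s) => //; rewrite cpx_line.
rewrite (_ : _ + _ = (1 - s)%:C * cpx z); last first.
  by rewrite rmorphB mulrBl mul1r mulrN.
by rewrite nsqM z1 mulr1 /nsq /= expr0n addr0; nra.
Unshelve. all: by end_near.
Qed.

(** * Blaschke factors, Poisson kernels and first-order estimates at the circle *)

(** Expansion of the product to first order with a quadratic error. It serves with [x i] a multiple
    of [1 - nsq z], which tends to 0 at the circle. Nonnegativity of the sum carries the lower bound
    through the induction. *)
Lemma prod_1subr_bounds (R : realDomainType) (I : Type) (s : seq I) (x : I -> R) :
  (forall i, 0 <= x i <= 1) ->
  [/\ 0 <= \prod_(i <- s) (1 - x i), 0 <= \sum_(i <- s) x i,
      1 - \sum_(i <- s) x i <= \prod_(i <- s) (1 - x i) &
      \prod_(i <- s) (1 - x i)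
        <= 1 - \sum_(i <- s) x i + (\sum_(i <- s) x i) ^+ 2].
Proof.
move=> x01; elim: s => [|i s [P0 S0 lo up]].
  by rewrite !big_nil expr0n /= addr0 subr0; split; rewrite ?ler01.
rewrite !big_cons; move: (x i) (x01 i) => y /andP[y0 y1].
move: (\prod_(i <- s) _) (\sum_(i <- s) _) P0 S0 lo up => P S P0 S0 lo up.
by split; nra.
Qed.

Definition bnum (R : realType) (n : nat) (a : 'I_n -> R[i]) : {poly R[i]} :=
  \prod_(j < n) ('X - (a j)%:P).

Definition bden (R : realType) (n : nat) (a : 'I_n -> R[i]) : {poly R[i]} :=
  \prod_(j < n) (1 - ((a j)^*)%:P * 'X).

Lemma horner_bnum (R : realType) n (a : 'I_n -> R[i]) z :
  (bnum a).[z] = \prod_(j < n) (z - a j).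
Proof. by rewrite horner_prod; apply: eq_bigr => j _; rewrite hornerXsubC. Qed.

Lemma horner_bden (R : realType) n (a : 'I_n -> R[i]) z :
  (bden a).[z] = \prod_(j < n) (1 - (a j)^* * z).
Proof.
rewrite horner_prod; apply: eq_bigr => j _.
by rewrite hornerD hornerN hornerCM hornerX hornerC.
Qed.

Lemma nsqJ (R : realType) (z : R[i]) : nsq z^* = nsq z.
Proof. by case: z => a b; rewrite /nsq /= sqrrN. Qed.

Lemma nsq_prod (R : realType) (I : Type) (s : seq I) (F : I -> R[i]) :
  nsq (\prod_(j <- s) F j) = \prod_(j <- s) nsq (F j).
Proof.
elim: s => [|i s IH]; last by rewrite !big_cons nsqM IH.
by rewrite !big_nil /nsq /= expr1n expr0n addr0.
Qed.

Lemma sub1_conj_neq0 (R : realType) (a z : R[i]) :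
  nsq a < 1 -> nsq z <= 1 -> 1 - a^* * z != 0.
Proof.
move=> a1 z1; rewrite subr_eq0; apply/eqP => h.
have : nsq a * nsq z = 1 by rewrite -nsqJ -nsqM -h /nsq /= expr1n expr0n addr0.
by have := nsq_ge0 a; have := nsq_ge0 z; nra.
Qed.

Lemma bden_neq0 (R : realType) n (a : 'I_n -> R[i]) z :
  (forall j, nsq (a j) < 1) -> nsq z <= 1 -> (bden a).[z] != 0.
Proof.
move=> a1 z1; rewrite horner_bden; apply/prodf_neq0 => j _.
exact: sub1_conj_neq0.
Qed.

(** On the circle [nsq (1 - a^* * z) = nsq (z - a)], so this is the Poisson kernel there; the
    present form is also regular throughout the closed disc. *)
Definition poisson (R : realType) (a z : R[i]) : R :=
  (1 - nsq a) / nsq (1 - a^* * z).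

Lemma continuous_poisson (R : realType) (a : R[i]) (x : R * R) :
  nsq a < 1 -> nsq (cpx x) <= 1 ->
  {for x, continuous (fun w : R * R => poisson a (cpx w))}.
Proof.
move=> a1 x1; have hornerE w : (1 - a^*%:P * 'X).[w] = 1 - a^* * w.
  by rewrite hornerD hornerN hornerCM hornerX hornerC.
have -> : (fun w : R * R => poisson a (cpx w)) =
    (fun w => (1 - nsq a) / nsq (1 - a^*%:P * 'X).[cpx w]).
  by apply: funext => w; rewrite hornerE.
apply: cvgM; first exact: cvg_cst.
apply: cvgV; last exact: continuous_nsq_horner.
by rewrite hornerE nsq_eq0 sub1_conj_neq0.
Qed.

(** Restates the identity [|1 - a^* z|^2 - |z - a|^2 = (1 - |z|^2) (1 - |a|^2)] so that the defect
    of the factor from modulus 1 is visibly of first order in [1 - nsq z]. *)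
Lemma nsq_mobius (R : realType) (a z : R[i]) :
  nsq a < 1 -> nsq z <= 1 ->
  nsq (z - a) = nsq (1 - a^* * z) * (1 - (1 - nsq z) * poisson a z).
Proof.
move=> a1 z1; have := sub1_conj_neq0 a1 z1; rewrite -nsq_eq0 /poisson => h.
transitivity (nsq (1 - a^* * z) - (1 - nsq z) * (1 - nsq a)).
  by case: a z {a1 z1 h} => [a1 a2] [z1 z2]; rewrite /nsq /=; ring.
by move: h; move: (nsq (1 - a^* * z)) => A h; field.
Qed.

(** The upper bound is the nonnegativity of [nsq (z - a)] read through [nsq_mobius]. *)
Lemma poisson_bounds (R : realType) (a z : R[i]) :
  nsq a < 1 -> nsq z <= 1 -> 0 <= (1 - nsq z) * poisson a z <= 1.
Proof.
move=> a1 z1; have h := sub1_conj_neq0 a1 z1.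
have h0 : 0 < nsq (1 - a^* * z) by rewrite lt_def nsq_eq0 h nsq_ge0.
apply/andP; split; first by rewrite mulr_ge0 ?divr_ge0 ?subr_ge0// ltW.
have := nsq_ge0 (z - a); rewrite nsq_mobius// pmulr_rge0//.
by rewrite subr_ge0.
Qed.

Lemma nsq_bnum (R : realType) n (a : 'I_n -> R[i]) z :
  (forall j, nsq (a j) < 1) -> nsq z <= 1 ->
  nsq (bnum a).[z] =
    nsq (bden a).[z] * \prod_(j < n) (1 - (1 - nsq z) * poisson (a j) z).
Proof.
move=> a1 z1; rewrite horner_bnum horner_bden !nsq_prod -big_split /=.
by apply: eq_bigr => j _; exact: nsq_mobius.
Qed.

Lemma nsq_bnum_circle (R : realType) n (a : 'I_n -> R[i]) z :
  (forall j, nsq (a j) < 1) -> nsq z = 1 -> nsq (bnum a).[z] = nsq (bden a).[z].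
Proof.
move=> a1 z1; rewrite nsq_bnum ?z1// big1 ?mulr1// => j _.
by rewrite subrr mul0r subr0.
Qed.

(** Logarithmic differentiation: each factor contributes [- a^* z / (1 - a^* z) = 1 - 1 / (1 - a^*
    z)]. *)
Lemma mul_deriv_bden (R : realType) n (a : 'I_n -> R[i]) z :
  (forall j, 1 - (a j)^* * z != 0) ->
  z * (bden a)^`().[z] = (bden a).[z] * \sum_(j < n) (1 - (1 - (a j)^* * z)^-1).
Proof.
move=> a0; rewrite /bden; elim: (index_enum _) => [|j s IH].
  by rewrite !big_nil -polyC1 derivC horner0 !mulr0.
rewrite !big_cons derivM hornerD !hornerM mulrDr.
rewrite [z * (_ * (\prod_(j <- s) _)^`().[z])]mulrCA IH.
have -> : (1 - (a j)^*%:P * 'X)^`() = (- (a j)^*)%:P.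
  by rewrite derivB -polyC1 derivC mul_polyC derivZ derivX sub0r alg_polyC polyCN.
rewrite !(hornerD, hornerN, hornerCM, hornerX, hornerC).
move: (a0 j); move: (_.[z]) (\sum_(_ <- _) _) => P S h.
by field.
Qed.

(** For [w = a^* z] one has [2 Re (1 / (1 - w)) = 1 + (1 - |w|^2) / |1 - w|^2], and [|w| = |a|] on
    the circle. *)
Lemma Re_inv_sub1 (R : realType) (a z : R[i]) : nsq a < 1 -> nsq z = 1 ->
  Re (1 - (1 - a^* * z)^-1) = (1 - poisson a z) / 2.
Proof.
move=> a1 z1; have : 1 - a^* * z != 0 by rewrite sub1_conj_neq0 ?z1.
rewrite -nsq_eq0; have aE : nsq (a^* * z) = nsq a by rewrite nsqM nsqJ z1 mulr1.
rewrite raddfB /= -[(_)^-1]mul1r Re_divc /poisson -aE.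
case: (a^* * z) => x y; rewrite /nsq /= => h.
by rewrite mul0r mul1r addr0; rewrite sub0r in h *; field.
Qed.

(** * Polynomial identities recovering denominators and numerators *)

(** The difference [E] solves the linear equation [E' q = q' E] with [E(0) = 0] and [q(0) = 1], so
    its coefficients vanish one after another. *)
Lemma eq_of_deriv_cross (F : numDomainType) (p q : {poly F}) :
  p.[0] = 1 -> q.[0] = 1 -> p^`() * q = q^`() * p -> p = q.
Proof.
rewrite !horner_coef0 => p0 q0 pq; apply/eqP; rewrite -subr_eq0; apply/eqP.
set E := p - q.
have cross : E^`() * q = q^`() * E by rewrite derivB mulrBl pq mulrBr.
suff E0 m : forall k, (k <= m)%N -> E`_k = 0.
  by apply/polyP => k; rewrite coef0; exact: (E0 k).
elim: m => [|m IH] k; first by rewrite leqn0 => /eqP->; rewrite coefB p0 q0 subrr.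
rewrite leq_eqVlt => /orP[/eqP->|]; last exact: IH.
have := congr1 (fun s : {poly F} => s`_m) cross; rewrite !coefM big_ord_recr /=.
rewrite big1 ?add0r; last by move=> i _; rewrite coef_deriv IH ?mul0rn ?mul0r.
rewrite subnn q0 mulr1 coef_deriv big1; last first.
  by move=> i _; rewrite IH ?mulr0 ?leq_subr.
by move=> /eqP; rewrite mulrn_eq0 /= => /eqP.
Qed.

Lemma eq_poly_numeric (F : numDomainType) (p q : {poly F}) :
  (forall x, x != 0 -> p.[x] = q.[x]) -> p = q.
Proof.
move=> pq; apply/eqP; rewrite -subr_eq0; apply: contraT => d0.
(* The integers 1, 2, ..., up to the size of the difference, are nonzero roots, one more than its
   degree allows. *)
have := max_poly_roots d0 (rs := [seq k.+1%:R | k <- iota 0 (size (p - q))]).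
rewrite size_map size_iota ltnn => -> //.
  apply/allP => _ /mapP[k _ ->].
  by rewrite /root hornerD hornerN pq ?subrr// pnatr_eq0.
by rewrite map_inj_uniq ?iota_uniq// => i j /eqP; rewrite eqr_nat => /eqP[].
Qed.

(** Reflection in the circle: [z - a] is [z] times the conjugate of [1 - a^* / z^*], so the
    denominator determines the numerator away from 0. *)
Lemma bnum_bden_eq (R : realType) n (a c : 'I_n -> R[i]) :
  bden a = bden c -> bnum a = bnum c.
Proof.
have refl (b : 'I_n -> R[i]) z : z != 0 ->
    (bnum b).[z] = z ^+ n * ((bden b).[(z^*)^-1])^*.
  move=> z0; rewrite horner_bnum horner_bden rmorph_prod -[X in z ^+ X]card_ord.
  rewrite -prodr_const -big_split /=; apply: eq_bigr => j _.
  by rewrite rmorphB rmorphM rmorph1 /= fmorphV /= !conjCK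
    mulrBr mulr1 mulrCA divff ?mulr1.
by move=> ac; apply: eq_poly_numeric => z z0; rewrite !refl// ac.
Qed.

(** * Consequences of the inclusion of level sets inside the closed disc *)

Section Inclusion.
Variables (R : realType) (n : nat) (a c : 'I_n -> R[i]) (r : R).
Hypotheses (a1 : forall j, nsq (a j) < 1) (c1 : forall j, nsq (c j) < 1).
Hypotheses (r0 : 0 < r) (r1 : r < 1).
Hypothesis sub : forall z, nsq z <= 1 ->
  nsq (bnum a).[z] < r ^+ 2 * nsq (bden a).[z] ->
  nsq (bnum c).[z] < r ^+ 2 * nsq (bden c).[z].

Let r2 : 0 < r ^+ 2 < 1. Proof. by rewrite exprn_gt0 //= expr_lt1 // ltW. Qed.

Let nsq_bden_gt0 (b : 'I_n -> R[i]) z : (forall j, nsq (b j) < 1) ->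
  nsq z <= 1 -> 0 < nsq (bden b).[z].
Proof. by move=> b1 z1; rewrite lt_def nsq_eq0 nsq_ge0 bden_neq0. Qed.

(** Maximum principle for C/B on the part [K] of the closed disc where |C| >= r. There |B| >= r, so
    C/B has no pole; on the circle both moduli are 1, where |C| = r the bound is |B| >= r, and every
    other point of [K] is interior. *)
Lemma cross_le (z : R[i]) : nsq z <= 1 ->
  r ^+ 2 * nsq (bden c).[z] <= nsq (bnum c).[z] ->
  nsq (bnum c).[z] * nsq (bden a).[z] <= nsq (bnum a).[z] * nsq (bden c).[z].
Proof.
move=> z1 zc; have /andP[r20 r21] := r2.
have onK w : nsq w <= 1 -> r ^+ 2 * nsq (bden c).[w] <= nsq (bnum c).[w] ->
    r ^+ 2 * nsq (bden a).[w] <= nsq (bnum a).[w].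
  by move=> w1; rewrite !leNgt; apply: contra; exact: sub.
(* A constant quotient is settled separately: evaluation at 1, a point of the circle, gives the
   constant modulus 1. *)
have [[f0 NE]|nconst] :=
    pselect (exists f0, bnum c * bden a = f0 *: (bnum a * bden c)).
  have n1 : nsq (1 : R[i]) = 1 by rewrite /nsq /= expr1n expr0n addr0.
  have E1 : nsq (bden c).[1] * nsq (bden a).[1] =
      nsq f0 * (nsq (bden c).[1] * nsq (bden a).[1]).
    have := congr1 (fun p => nsq p.[1]) NE.
    by rewrite hornerZ !hornerM !nsqM !nsq_bnum_circle//
      [nsq (bden a).[1] * _]mulrC.
  have f01 : nsq f0 = 1.
    have h : nsq (bden c).[1] * nsq (bden a).[1] != 0.
      by rewrite gt_eqF// mulr_gt0 ?nsq_bden_gt0 ?n1.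
    by apply: (mulIf h); rewrite -E1 mul1r.
  have := congr1 (fun p => nsq p.[z]) NE.
  by rewrite hornerZ !hornerM !nsqM f01 mul1r => ->.
pose K := [set w : R * R | nsq (cpx w) <= 1] `&`
  [set w : R * R | r ^+ 2 * nsq (bden c).[cpx w] <= nsq (bnum c).[cpx w]].
have clc : continuous (fun w : R * R => r ^+ 2 * nsq (bden c).[cpx w]).
  by move=> w; apply: cvgM; [exact: cvg_cst|exact: continuous_nsq_horner].
have cnc : continuous (fun w : R * R => nsq (bnum c).[cpx w]).
  exact: continuous_nsq_horner.
have cK : compact K.
  apply: (subclosed_compact _ (@compact_disc R)); last by move=> w [].
  apply: closedI; last exact: closed_le_fun.
  by apply: closed_le_fun; [exact: continuous_cpx_nsq|move=> w; exact: cvg_cst].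
have := @nsq_quotient_le R (bnum c * bden a) (bnum a * bden c) K cK
  _ _ _ (Re z, Im z).
rewrite (_ : cpx (Re z, Im z) = z); last by case: (z).
rewrite !hornerM !nsqM; apply.
- move=> w [/= w1 wc]; rewrite hornerM mulf_neq0 ?bden_neq0// -nsq_eq0 gt_eqF//.
  by apply: lt_le_trans (onK _ w1 wc); rewrite mulr_gt0 ?nsq_bden_gt0.
- move=> w [/= w1 wc]; rewrite !hornerM !nsqM.
  have := w1; rewrite le_eqVlt => /orP[/eqP w1'|w1'].
    by left; rewrite !nsq_bnum_circle// mulrC.
  have := wc; rewrite le_eqVlt => /orP[/eqP wc'|wc'].
    left; rewrite -wc' mulrAC ler_wpM2r ?nsq_ge0//.
    exact: onK.
  right.
  have n1 := cvgr_lt _ (@continuous_cpx_nsq R w) _ w1'.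
  have n2 : \forall v \near w,
      0 < nsq (bnum c).[cpx v] - r ^+ 2 * nsq (bden c).[cpx v].
    by apply: (cvgr_gt _ (cvgB (cnc w) (clc w))); rewrite subr_gt0.
  near=> v; split; apply: ltW; first by near: v; exact: n1.
  by rewrite -subr_gt0; near: v; exact: n2.
- by move=> f0; apply/eqP => h; apply: nconst; exists f0.
- by split; rewrite /= (_ : cpx _ = z)//; case: (z).
Unshelve. all: by end_near.
Qed.

Lemma sum_poisson_le (z : R[i]) : nsq z = 1 ->
  \sum_(j < n) poisson (a j) z <= \sum_(j < n) poisson (c j) z.
Proof.
have [x <-] : exists x, cpx x = z by exists (Re z, Im z); case: (z).
move=> z1; rewrite leNgt; apply/negP => lt_ca; have /andP[r20 r21] := r2.
pose S (b : 'I_n -> R[i]) (w : R * R) := \sum_(j < n) poisson (b j) (cpx w).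
have cS (b : 'I_n -> R[i]) : (forall j, nsq (b j) < 1) ->
    {for x, continuous (S b)}.
  move=> b1; rewrite /S; apply: cvg_big => [|j _]; first exact: add_continuous.
  by apply: continuous_poisson; rewrite ?z1.
(* Positivity of [g] puts [w] where [cross_le] applies; positivity of [h] is the assumed strict
   inequality with the quadratic error included, after division by [1 - nsq (cpx w)]. *)
pose g w := nsq (bnum c).[cpx w] - r ^+ 2 * nsq (bden c).[cpx w].
pose h w := S a w - S c w - (1 - nsq (cpx w)) * (S a w * S a w).
have cg : {for x, continuous g}.
  apply: cvgB; first exact: continuous_nsq_horner.
  by apply: cvgM; [exact: cvg_cst|exact: continuous_nsq_horner].
have ch : {for x, continuous h}.
  apply: cvgB; first by apply: cvgB; exact: cS.
  apply: cvgM; last by apply: cvgM; exact: cS.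
  by apply: cvgB; [exact: cvg_cst|exact: continuous_cpx_nsq].
have gx : \forall w \near x, 0 < g w.
  apply: (cvgr_gt _ cg); rewrite /g nsq_bnum_circle// subr_gt0.
  by rewrite gtr_pMl// nsq_bden_gt0 ?z1.
have hx : \forall w \near x, 0 < h w.
  by apply: (cvgr_gt _ ch); rewrite /h z1 subrr mul0r subr0 subr_gt0.
have [w [gw hw] w1] : exists2 w, 0 < g w /\ 0 < h w & nsq (cpx w) < 1.
  apply: (exists_in_open_disc z1).
  near=> w; split; first by near: w; exact: gx.
  by near: w; exact: hx.
have w1' := ltW w1.
have := cross_le w1'; rewrite -subr_ge0 => /(_ (ltW gw)).
have Qa := nsq_bden_gt0 a1 w1'; have Qc := nsq_bden_gt0 c1 w1'.
(* Once the moduli of the denominators cancel, the lower bound for the product of [c] and the upper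
   bound for that of [a] contradict [h w > 0]. *)
rewrite !nsq_bnum// mulrAC [X in _ <= X]mulrC mulrA ler_pM2l ?mulr_gt0//.
have [_ _ loc _] := prod_1subr_bounds (index_enum _)
  (fun j => poisson_bounds (c1 j) w1').
have [_ _ _ upa] := prod_1subr_bounds (index_enum _)
  (fun j => poisson_bounds (a1 j) w1').
move=> /(le_trans loc) /le_trans /(_ upa).
rewrite -!mulr_sumr -/(S a w) -/(S c w); move: hw w1; rewrite /h.
move: (S a w) (S c w) (nsq (cpx w)) => A C s hs s1.
have : 0 < (1 - s) * (A - C - (1 - s) * (A * A)).
  by rewrite mulr_gt0 // subr_gt0.
by rewrite expr2; nra.
Unshelve. all: by end_near.
Qed.

Lemma bden_eq : bden a = bden c.
Proof.
(* Divided by [bden a * bden c], this is z times the difference of the logarithmic derivatives of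
   [bden a] and [bden c]. Its real part on the circle is half the difference of the Poisson sums, as
   the [n] constant terms cancel. *)
pose N := - ('X * ((bden c)^`() * bden a - (bden a)^`() * bden c)).
have N0 : N = 0.
  apply: (@Re_quotient_eq0 R N (bden a * bden c)).
  - by move=> z z1; rewrite hornerM mulf_neq0 ?bden_neq0.
  - by rewrite /N hornerN hornerM hornerX mul0r oppr0.
  - move=> z z1; have z1' : nsq z <= 1 by rewrite z1.
    have -> : N.[z] / (bden a * bden c).[z] =
        \sum_(j < n) (1 - (1 - (a j)^* * z)^-1) -
        \sum_(j < n) (1 - (1 - (c j)^* * z)^-1).
      have := mul_deriv_bden (fun j => sub1_conj_neq0 (a1 j) z1').
      have := mul_deriv_bden (fun j => sub1_conj_neq0 (c1 j) z1').
      have := bden_neq0 a1 z1'; have := bden_neq0 c1 z1'.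
      rewrite /N hornerN !hornerM hornerX hornerD hornerN !hornerM mulrBr !mulrA.
      move=> Qc Qa -> ->; move: Qc Qa.
      move: (_.[z]) (_.[z]) (\sum_(_ < _) _) (\sum_(_ < _) _) => Qc Qa Sc Sa.
      by move=> *; field; apply/andP.
    have ReE (b : 'I_n -> R[i]) : (forall j, nsq (b j) < 1) ->
        Re (\sum_(j < n) (1 - (1 - (b j)^* * z)^-1)) =
        \sum_(j < n) (1 - poisson (b j) z) / 2.
      by move=> b1; rewrite raddf_sum; apply: eq_bigr => j _; exact: Re_inv_sub1.
    rewrite raddfB /= !ReE// -!mulr_suml !sumrB.
    by have := sum_poisson_le z1; lra.
have den0 (b : 'I_n -> R[i]) : (bden b).[0] = 1.
  by rewrite horner_bden big1// => j _; rewrite mulr0 subr0.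
apply/esym/eq_of_deriv_cross; rewrite ?den0//.
move/eqP: N0; rewrite oppr_eq0 mulf_eq0 polyX_eq0 /= subr_eq0 => /eqP ->.
by [].
Qed.

End Inclusion.

(** * From rational functions and level sets to polynomial inequalities *)

Lemma norm_lt_nsq (R : realType) (z : R[i]) (r : R) : 0 < r ->
  (`|z| < r%:C) = (nsq z < r ^+ 2).
Proof.
move=> r0; rewrite normc_def ltcR -[X in _ = (X < _)]sqr_sqrtr ?nsq_ge0//.
by rewrite ltr_pXn2r ?nnegrE ?sqrtr_ge0// ltW.
Qed.

Lemma norm_eq1_nsq (R : realType) (z : R[i]) : `|z| = 1 -> nsq z = 1.
Proof.
by move=> z1; apply: complexI; rewrite add_Re2_Im2 z1 expr1n.
Qed.

Lemma bden_poly_neq0 (R : realType) n (a : 'I_n -> R[i]) : bden a != 0.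
Proof.
apply/eqP => /(congr1 (horner^~ 0)); rewrite horner_bden big1 ?horner0.
  by move/eqP; rewrite oner_eq0.
by move=> j _; rewrite mulr0 subr0.
Qed.

Lemma blaschkeE (R : realType) n (lambda : R[i]) (a : 'I_n -> R[i]) :
  blaschke lambda a = (lambda *: bnum a)%:F / (bden a)%:F.
Proof.
rewrite /blaschke /ratfun_const prodf_div -!rmorph_prod /= -/(bnum a) -/(bden a).
by rewrite -mul_polyC rmorphM /= mulrA.
Qed.

(** Any representation [p / q] with [q.[z] != 0] gives the same value as the standard one, by
    cross-multiplication, since [bden a] has no zero in the closed disc. *)
Lemma level_set_blaschke (R : realType) n (lambda : R[i]) (a : 'I_n -> R[i])
    (r : R) (z : R[i]) :
  `|lambda| = 1 -> (forall j, nsq (a j) < 1) -> 0 < r -> nsq z <= 1 ->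
  level_set r (blaschke lambda a) z <->
  nsq (bnum a).[z] < r ^+ 2 * nsq (bden a).[z].
Proof.
move=> l1 a1 r0 z1; have Q0 := bden_neq0 a1 z1.
have Q0' : 0 < nsq (bden a).[z] by rewrite lt_def nsq_eq0 Q0 nsq_ge0.
have valE : (`|(lambda *: bnum a).[z] / (bden a).[z]| < r%:C) =
    (nsq (bnum a).[z] < r ^+ 2 * nsq (bden a).[z]).
  rewrite norm_lt_nsq// nsqM nsqV hornerZ nsqM (norm_eq1_nsq l1) mul1r.
  by rewrite ltr_pdivrMr.
split; rewrite /level_set /= -valE.
  move=> [w [p [q [fE q0 ->]]]].
  suff -> : p.[z] / q.[z] = (lambda *: bnum a).[z] / (bden a).[z] by [].
  have qn0 : q%:F != 0.
    by rewrite tofrac_eq0; apply: contra q0 => /eqP->; rewrite horner0.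
  have dn0 : (bden a)%:F != 0 by rewrite tofrac_eq0 bden_poly_neq0.
  move/eqP: fE; rewrite blaschkeE (eqr_div _ _ dn0 qn0) -!tofracM tofrac_eq => /eqP.
  move=> /(congr1 (horner^~ z)); rewrite !hornerM => E.
  by apply/eqP; rewrite eqr_div// -E; apply/eqP.
move=> h; eexists; last exact: h.
by exists (lambda *: bnum a), (bden a); split=> //; exact: blaschkeE.
Qed.

Theorem theorem1p3 (R : realType) (n : nat) (B C : ratfun R)
    (hB : finite_blaschke n B) (hC : finite_blaschke n C)
    (hBC : exists r : R, 0 < r < 1 /\ level_set r B `<=` level_set r C) :
  exists lambda : R[i], `|lambda| = 1 /\ B = ratfun_const lambda * C.
Proof.
move: hB hC hBC => [l [a [l1 a1 ->]]] [m [c [m1 c1 ->]]] [r [/andP[r0 r1] sub]].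
have lt1 (b : 'I_n -> R[i]) : (forall j, `|b j| < 1) -> forall j, nsq (b j) < 1.
  by move=> b1 j; rewrite -[ltRHS](expr1n _ 2) -norm_lt_nsq.
have {}a1 := lt1 _ a1; have {}c1 := lt1 _ c1.
have Q : bden a = bden c.
  apply: (bden_eq a1 c1 r0 r1) => z z1.
  rewrite -(level_set_blaschke l1 a1 r0 z1) -(level_set_blaschke m1 c1 r0 z1).
  exact: sub.
(* Numerators and denominators now agree, so only the unimodular constants differ. *)
exists (l / m); split; first by rewrite normf_div l1 m1 divr1.
have m0 : m != 0 by rewrite -normr_eq0 m1 oner_eq0.
rewrite !blaschkeE Q (bnum_bden_eq Q) /ratfun_const mulrA -rmorphM /=.
by rewrite mul_polyC scalerA divfK.
Qed.
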